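(* If $G$ is a finite group of nilpotency class $2$ then $$\rho_0(G) < \sqrt{|G:Z(G)|}.$$
   Context: A triple $(S,T,U)$ of subgroups of a group $G$ is a subgroup TPP triple of $G$ (satisfies the triple product property) if for all $s\in S$, $t\in T$, $u\in U$ one has $stu=1 \iff s=t=u=1$. For a finite group $G$ the subgroup TPP ratio is $\rho_0(G) := \max \frac{|S||T||U|}{|G|}$, where the maximum is over all subgroup TPP triples $(S,T,U)$ of $G$. $Z(G)$ is the centre of $G$ and $G'$ its commutator subgroup. A group $G$ has nilpotency class $2$ if it is nonabelian and $\{1\} < G' \leq Z(G) < G$. *)

(* Defs.v *)
From mathcomp Require Import all_boot all_order all_algebra all_fingroup all_solvable.

Set Implicit Arguments.
Unset Strict Implicit.
Unset Printing Implicit Defensive.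

Import Order.TTheory GRing.Theory Num.Theory.

Section SubgroupTPP.

Variable gT : finGroupType.
Implicit Types G S T U : {group gT}.

Definition subgroup_TPP G S T U : bool :=
  [&& S \subset G, T \subset G, U \subset G &
   [forall s in S, forall t in T, forall u in U,
      (s * t * u == 1)%g == [&& s == 1%g, t == 1%g & u == 1%g]]].

Lemma subgroup_TPP_P G S T U :
  reflect ([/\ S \subset G, T \subset G & U \subset G] /\
           forall s t u, s \in S -> t \in T -> u \in U ->
             (s * t * u = 1)%g <-> [/\ s = 1%g, t = 1%g & u = 1%g])
          (subgroup_TPP G S T U).
Proof.
apply: (iffP and4P) => [[sS sT sU tpp] | [[sS sT sU] tpp]]; split=> //.
  move=> s t u Ss Tt Uu.
  have /forall_inP/(_ t Tt)/forall_inP/(_ u Uu)/eqP E := forall_inP tpp s Ss.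
  split=> [/eqP | [-> -> ->]]; last by rewrite !mulg1.
  by rewrite E => /and3P[/eqP-> /eqP-> /eqP->].
apply/forall_inP=> s Ss; apply/forall_inP=> t Tt; apply/forall_inP=> u Uu.
apply/eqP; apply/eqP/and3P => [/(tpp s t u Ss Tt Uu)[-> -> ->] | ].
  by rewrite eqxx.
by case=> /eqP-> /eqP-> /eqP->; rewrite !mulg1.
Qed.

Local Open Scope ring_scope.

(* The base value 0 does not affect the maximum: all ratios are positive and *)
(* (1, 1, 1) is always a TPP triple; see rho0_attained and rho0_ge.          *)
Definition rho0 (R : realFieldType) G : R :=
  \big[Num.max/0]_(X : {group gT} * {group gT} * {group gT}
                     | subgroup_TPP G X.1.1 X.1.2 X.2)
    ((#|X.1.1| * #|X.1.2| * #|X.2|)%N%:R / #|G|%:R).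

Lemma rho0_ge (R : realFieldType) G S T U : subgroup_TPP G S T U ->
  (#|S| * #|T| * #|U|)%N%:R / #|G|%:R <= rho0 R G.
Proof.
by move=> tpp; apply: (le_bigmax_cond _ (j := (S, T, U))
  (fun X : {group gT} * {group gT} * {group gT} =>
     (#|X.1.1| * #|X.1.2| * #|X.2|)%N%:R / #|G|%:R : R)).
Qed.

Lemma rho0_attained (R : realFieldType) G :
  exists S T U, subgroup_TPP G S T U /\
    rho0 R G = (#|S| * #|T| * #|U|)%N%:R / #|G|%:R.
Proof.
have tpp1 : subgroup_TPP G 1%G 1%G 1%G.
  apply/subgroup_TPP_P; split; first by rewrite !sub1G.
  by move=> s t u /set1P-> /set1P-> /set1P->; rewrite !mulg1.
have : rho0 R G != 0.
  rewrite gt_eqF //; apply: lt_le_trans (rho0_ge R tpp1).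
  by rewrite divr_gt0 // ltr0n ?muln_gt0 !cardG_gt0.
rewrite /rho0; elim/big_ind: _ => [|x y Hx Hy|[[S T] U] /= tpp _].
- by rewrite eqxx.
- by case: leP.
- by exists S, T, U.
Qed.

Definition nilpotent_class2 G : bool :=
  ~~ abelian G &&
  [&& [1 gT]%g \proper G^`(1)%g, G^`(1)%g \subset 'Z(G)%g & 'Z(G)%g \proper G].

Lemma nilpotent_class2E G : nilpotent_class2 G = (nil_class G == 2).
Proof.
rewrite /nilpotent_class2 eqn_leq nil_class2 ltnNge nil_class1.
rewrite properE sub1G subG1 derg1 -/(G^`(1)%g).
rewrite properE center_sub /=.
have -> : (([~: G, G] == 1) = abelian G)%g by apply/eqP/idP => [/commG1P|/commG1P].
have -> : (G \subset 'Z(G))%g = abelian G by rewrite subsetI subxx.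
by case: (abelian G); rewrite ?andbF ?andbT.
Qed.

End SubgroupTPP.

(* Main.v *)
Require Import Defs.
From mathcomp Require Import all_boot all_order all_algebra all_fingroup all_solvable.
From mathcomp Require Import ring.

(** Let Z be the centre of G and V = G / Z; write S0, T0, U0 for the
    intersections of S, T, U with Z.  The claim for a TPP triple (S, T, U) is
    (|S||T||U|)^2 < |G|^2 |V|, and it follows from looking at the central
    elements of the pairwise products ST, TU and US.

    A coset of Z meets ST in at most as many points as Z itself does, so
    |S||T| = |ST| <= |V| |ST n Z| ([card_mul_le_index_center]).  The sets
    ST n Z and TU n Z are subgroups of Z, and the triple product property makes
    them meet exactly in T0 ([tpp_central_prodI]); hence
    |ST n Z| |TU n Z| <= |Z| |T0|.  Multiplying the cyclic versions of both
    estimates gives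
      (|S||T||U|)^4 <= |V|^6 |Z|^3 |S0||T0||U0|.

    The product S0 T0 U0 is direct inside Z, so |S0||T0||U0| <= |Z|, which is
    the wanted bound up to strictness.  If S0 T0 U0 is a proper subset of Z the
    bound is strict.  Otherwise S0 T0 U0 contains G' (this is where class 2
    enters), every commutator can be absorbed into S, T and U, and
    multiplication S x T x U -> G is injective as it would be in an abelian
    group ([tpp_card_mul3]); then |S||T||U| <= |G| < |G| sqrt |V|. *)

Set Implicit Arguments.
Unset Strict Implicit.
Unset Printing Implicit Defensive.

Import Order.TTheory GRing.Theory Num.Theory.

Section SubgroupTPPInClass2.

Local Open Scope group_scope.

Variable gT : finGroupType.
Implicit Types G H S T U : {group gT}.

(** * Elementary properties of TPP triples *)

Lemma tpp_eq1 G S T U s t u :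
  subgroup_TPP G S T U -> s \in S -> t \in T -> u \in U ->
  s * t * u = 1 -> [/\ s = 1, t = 1 & u = 1].
Proof. by move=> /subgroup_TPP_P[_ tpp] Ss Tt Uu /tpp; apply. Qed.

Lemma tpp_rot G S T U : subgroup_TPP G S T U -> subgroup_TPP G T U S.
Proof.
move=> tpp; have /subgroup_TPP_P[[sS sT sU] _] := tpp.
apply/subgroup_TPP_P; split=> // t u s Tt Uu Ss.
split=> [tus1 | [-> -> ->]]; last by rewrite !mulg1.
have stu1 : s * t * u = 1 by rewrite -mulgA -(mulgK s (t * u)) tus1 mul1g mulgV.
by have [-> -> ->] := tpp_eq1 tpp Ss Tt Uu stu1.
Qed.

Lemma tpp_setI G S T U H :
  subgroup_TPP G S T U -> subgroup_TPP H (S :&: H) (T :&: H) (U :&: H).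
Proof.
move=> tpp; apply/subgroup_TPP_P; split; first by rewrite !subsetIr.
move=> s t u /setIP[Ss _] /setIP[Tt _] /setIP[Uu _].
split=> [|[-> -> ->]]; last by rewrite !mulg1.
exact: tpp_eq1 tpp Ss Tt Uu.
Qed.

Lemma tpp_tiL G S T U : subgroup_TPP G S T U -> S :&: T = 1.
Proof.
move=> tpp; apply/trivgP/subsetP=> x /setIP[Sx Tx]; apply/set1P.
have [] // := tpp_eq1 tpp Sx (groupVr Tx) (group1 U).
by rewrite mulgV mulg1.
Qed.

(** * Triples whose central parts absorb the commutators *)

Lemma mulg_interleave (rT : finGroupType) (s t u a b c : rT) :
    commute a t -> commute a u -> commute b u ->
  s * a * (t * b) * (u * c) = s * t * u * (a * b * c).
Proof.
move=> cat cau cbu; rewrite -!mulgA; congr (s * _).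
rewrite (mulgA a t) cat -!mulgA; congr (t * _).
by rewrite (mulgA b u) cbu -!mulgA (mulgA a u) cau -!mulgA.
Qed.

(** If s t u = s' t' u', then modulo H' the quotients s^-1 s', t^-1 t',
    u^-1 u' multiply to 1, as in an abelian group.  When H' lies in the product
    of the central parts, the discrepancy can be distributed over S, T and U,
    and the triple product property shows that the quotients were central,
    hence trivial.  For abelian H the inclusion is trivial; this case bounds
    the product of the central parts of a triple by the order of the centre. *)
Lemma tpp_card_mul3 H S T U :
    subgroup_TPP H S T U ->
    H^`(1) \subset (S :&: 'Z(H)) * (T :&: 'Z(H)) * (U :&: 'Z(H)) ->
  #|S * T * U| = (#|S| * #|T| * #|U|)%N.
Proof.
move=> tpp sH'; have /subgroup_TPP_P[[sS sT sU] _] := tpp.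
pose f (x : gT * gT * gT) := x.1.1 * x.1.2 * x.2.
have -> : S * T * U = f @: setX (setX S T) U.
  apply/setP=> x; apply/mulsgP/imsetP=> [[_ u /mulsgP[s t Ss Tt ->] Uu ->] | ].
    by exists (s, t, u) => //; rewrite !inE Ss Tt.
  case=> [[[s t] u]] /setXP[/setXP[/= Ss Tt] /= Uu] ->.
  by exists (s * t) u; rewrite ?mem_mulg.
rewrite card_in_imset ?cardsX // => -[[s t] u] [[s' t'] u'].
move=> /setXP[/setXP[/= Ss Tt] /= Uu] /setXP[/setXP[/= Ss' Tt'] /= Uu'].
rewrite /f /= => eq_stu.
have quot (A : {group gT}) x y :
    x \in A -> y \in A -> exists2 d, d \in A & y = x * d.
  by move=> Ax Ay; exists (x^-1 * y); rewrite ?mulKVg ?groupM ?groupV.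
have [a Sa def_s'] := quot S _ _ Ss Ss'.
have [b Tb def_t'] := quot T _ _ Tt Tt'.
have [c Uc def_u'] := quot U _ _ Uu Uu'.
rewrite {}def_s' {}def_t' {}def_u' {Ss' Tt' Uu' s' t' u' quot} in eq_stu *.
have H's x y : x \in H -> y \in H -> commute (coset H^`(1) x) (coset H^`(1) y).
  move=> Hx Hy.
  have /centsP := der_abelian 0 H; rewrite derg0.
  by apply; rewrite mem_quotient.
have nH'H := subsetP (der_norm 1 H).
have [Hs Ht Hu] : [/\ s \in H, t \in H & u \in H].
  by split; [apply: (subsetP sS) | apply: (subsetP sT) | apply: (subsetP sU)].
have [Ha Hb Hc] : [/\ a \in H, b \in H & c \in H].
  by split; [apply: (subsetP sS) | apply: (subsetP sT) | apply: (subsetP sU)].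
have H'abc : a * b * c \in H^`(1).
  apply: coset_idr; first by rewrite nH'H ?groupM.
  have /(congr1 (coset H^`(1))) := eq_stu.
  rewrite !morphM ?nH'H ?groupM //=.
  rewrite (mulg_interleave _ _ (H's _ _ Ha Ht) (H's _ _ Ha Hu) (H's _ _ Hb Hu)).
  by move=> /esym/(canRL (mulKg _)) ->; rewrite mulVg.
have /mulsgP[_ r /mulsgP[p q /setIP[Sp Zp] /setIP[Tq Zq] ->] /setIP[Ur Zr] eq_pqr]
  := subsetP sH' _ H'abc.
have comm x y : x \in 'Z(H) -> y \in H -> commute x y.
  by case/centerP=> _ cx Hy; apply: cx.
have [Hp Hq Hr] : [/\ p \in H, q \in H & r \in H].
  by split; apply: (subsetP (center_sub H)).
have cent3 x y z : x \in H -> y \in H -> z \in H ->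
    x * p^-1 * (y * q^-1) * (z * r^-1) = x * y * z * (p^-1 * q^-1 * r^-1).
  by move=> Hx Hy Hz; apply: mulg_interleave; apply: comm; rewrite ?groupV.
have dist1 : (a * p^-1) * (b * q^-1) * (c * r^-1) = 1.
  by rewrite cent3 // eq_pqr -cent3 // !mulgV !mulg1.
have [||| ap bq cr] := tpp_eq1 tpp _ _ _ dist1; rewrite ?groupM ?groupV //.
have {ap} ap : a = p by apply/eqP; rewrite eq_mulgV1 ap.
have {bq} bq : b = q by apply/eqP; rewrite eq_mulgV1 bq.
have {cr} cr : c = r by apply/eqP; rewrite eq_mulgV1 cr.
have abc1 : a * b * c = 1.
  apply: (mulgI (s * t * u)); rewrite mulg1 [RHS]eq_stu ap bq cr.
  by rewrite mulg_interleave //; apply: comm.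
have [a1 b1 c1] := tpp_eq1 tpp Sa Tb Uc abc1.
by rewrite a1 b1 c1 !mulg1.
Qed.

(** * Central elements of pairwise products *)

Lemma group_set_center_mul G S T :
  S \subset G -> T \subset G -> group_set ('Z(G) :&: (S * T)).
Proof.
move=> sS sT; apply/group_setP; split.
  by rewrite inE group1 -[1]mulg1 mem_mulg.
move=> x y /setIP[Zx /mulsgP[s t Ss Tt def_x]] /setIP[Zy STy].
rewrite inE groupM //=; have /mulsgP[s' t' Ss' Tt' ->] := STy.
have /centerP[_ cx] := Zx.
(* x is central, so it can be inserted between s' and t'. *)
rewrite mulgA cx ?(subsetP sS) // def_x mulgA -mulgA.
by rewrite mem_mulg ?groupM.
Qed.

(** If s t and s' t' lie in the same coset of the centre, then
    s^-1 s' t' t^-1 is central: translating by a fixed s and t sends each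
    fibre of ST over G / Z(G) injectively into the fibre over 1. *)
Lemma card_mul_le_index_center G S T :
    S \subset G -> T \subset G ->
  (#|(S * T)%g| <= #|G : 'Z(G)| * #|('Z(G) :&: (S * T))%g|)%N.
Proof.
move=> sS sT; set Z := 'Z(G); set X := S * T.
have sXG : X \subset G by rewrite mul_subG.
have nZG : G \subset 'N(Z) := normal_norm (center_normal G).
rewrite -card_quotient // -sum1_card (partition_big_imset (coset Z)) /=.
apply: (@leq_trans (\sum_(y in coset Z @: X) #|Z :&: X|)); last first.
  rewrite sum_nat_const leq_mul2r; apply/orP; right.
  apply/subset_leq_card/subsetP=> _ /imsetP[x Xx ->].
  by rewrite mem_quotient ?(subsetP sXG).
apply: leq_sum => y /imsetP[x0 /mulsgP[s t Ss Tt def_x0] def_y].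
rewrite {y}def_y {x0}def_x0 sum1_card.
have inj : injective (fun x : gT => s^-1 * x * t^-1).
  by move=> x y /mulIg /mulgI.
rewrite -(card_imset _ inj); apply/subset_leq_card/subsetP=> _ /imsetP[x Xx_eq ->].
move: Xx_eq; rewrite unfold_in => /andP[Xx /eqP eq_x].
have [Gs Gt] := (subsetP sS _ Ss, subsetP sT _ Tt).
have Gx := subsetP sXG _ Xx.
have Zd : (s * t)^-1 * x \in Z.
  apply: coset_idr; first by rewrite (subsetP nZG) // groupM ?groupV ?groupM.
  have /(subsetP nZG) Nst := groupM Gs Gt.
  by rewrite morphM ?morphV ?groupV ?(subsetP nZG x) //= eq_x mulVg.
have /centerP[_ cd] := Zd.
have -> : s^-1 * x * t^-1 = (s * t)^-1 * x.
  by apply: (mulIg t); rewrite mulgKV cd // invMg !mulgA mulgV mul1g.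
rewrite inE Zd /=; case/mulsgP: Xx => s' t' Ss' Tt' def_x.
have -> : (s * t)^-1 * x = (s^-1 * s') * (t' * t^-1).
  by apply: (mulIg t); rewrite cd // def_x invMg -!mulgA mulVg mulg1 mulKVg.
by rewrite mem_mulg ?groupM ?groupV.
Qed.

(** The product of a central s t and the inverse of the same element written
    as t' u has the shape s (t t') u, so the triple product property forces
    s = u = 1.  That inverse has the form t' u because the central elements of
    TU form a subgroup. *)
Lemma tpp_central_prodI G S T U :
    subgroup_TPP G S T U ->
  ('Z(G) :&: (S * T)) :&: ('Z(G) :&: (T * U)) \subset T :&: 'Z(G).
Proof.
move=> tpp; have /subgroup_TPP_P[[sS sT sU] _] := tpp.
have gTU := group_set_center_mul sT sU.
apply/subsetP=> z /setIP[/setIP[Zz /mulsgP[s t Ss Tt def_z]] TUz].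
have := @groupVr _ (Group gTU) z TUz => /setIP[_ /mulsgP[t' u Tt' Uu def_z']].
have E : s * (t * t') * u = 1.
  by rewrite (mulgA s) -(mulgA _ t') -def_z -def_z' mulgV.
have [s1 _ _] := tpp_eq1 tpp Ss (groupM Tt Tt') Uu E.
by rewrite inE Zz andbT def_z s1 mul1g.
Qed.

Lemma tpp_card_central_prod G S T U :
    subgroup_TPP G S T U ->
  (#|('Z(G) :&: (S * T))%g| * #|('Z(G) :&: (T * U))%g|
     <= #|'Z(G)| * #|T :&: 'Z(G)|)%N.
Proof.
move=> tpp; have /subgroup_TPP_P[[sS sT sU] _] := tpp.
have := mul_cardG (Group (group_set_center_mul sS sT))
                  (Group (group_set_center_mul sT sU)).
move=> /= ->; apply: leq_mul; apply: subset_leq_card.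
  by rewrite mul_subG // subsetIl.
exact: tpp_central_prodI tpp.
Qed.

Lemma tpp_card_pair G S T U :
    subgroup_TPP G S T U ->
  (#|S| * #|T| <= #|G : 'Z(G)| * #|('Z(G) :&: (S * T))%g|)%N.
Proof.
move=> tpp; have /subgroup_TPP_P[[sS sT _] _] := tpp.
by rewrite -(TI_cardMg (tpp_tiL tpp)) card_mul_le_index_center.
Qed.

(** * The bound in class 2 *)

(** The left-hand side is the square of (|S||T|)(|T||U|)(|U||S|).  Bounding each
    factor leaves the square of the product of the three central intersections,
    and this square regroups into one factor for each pair of them. *)
Lemma tpp_card_expn4_le G S T U :
    subgroup_TPP G S T U ->
  ((#|S| * #|T| * #|U|) ^ 4 <= #|G : 'Z(G)| ^ 6 *
    (#|'Z(G)| ^ 3 * (#|S :&: 'Z(G)| * #|T :&: 'Z(G)| * #|U :&: 'Z(G)|)))%N.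
Proof.
move=> tpp; have tpp' := tpp_rot tpp; have tpp'' := tpp_rot tpp'.
move: (tpp_card_pair tpp) (tpp_card_pair tpp') (tpp_card_pair tpp'').
move: (tpp_card_central_prod tpp) (tpp_card_central_prod tpp').
move: (tpp_card_central_prod tpp'').
set a := #|'Z(G) :&: (S * T)|; set b := #|'Z(G) :&: (T * U)|.
set c := #|'Z(G) :&: (U * S)|; set v := #|G : 'Z(G)|; set z := #|'Z(G)|.
move: #|S :&: 'Z(G)| #|T :&: 'Z(G)| #|U :&: 'Z(G)| => s0 t0 u0.
move: #|S| #|T| #|U| => s t u.
move=> ca ab bc st tu us.
have cube : ((a * b * c) ^ 2 <= z ^ 3 * (s0 * t0 * u0))%N.
  have -> : ((a * b * c) ^ 2 = (a * b) * (b * c) * (c * a))%N.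
    by rewrite expnS expn1; ring.
  have -> : (z ^ 3 * (s0 * t0 * u0) = (z * t0) * (z * u0) * (z * s0))%N.
    by rewrite !expnS expn0; ring.
  by apply: leq_mul => //; apply: leq_mul.
have -> : ((s * t * u) ^ 4 = ((s * t) * (t * u) * (u * s)) ^ 2)%N.
  by rewrite !expnS expn0; ring.
apply: (@leq_trans (((v * a) * (v * b) * (v * c)) ^ 2)%N).
  by rewrite leq_exp2r //; apply: leq_mul => //; apply: leq_mul.
have -> : (((v * a) * (v * b) * (v * c)) ^ 2 = v ^ 6 * (a * b * c) ^ 2)%N.
  by rewrite !expnS expn0; ring.
by rewrite leq_mul2l cube orbT.
Qed.

Lemma class2_tpp_lt G S T U :
    nilpotent_class2 G -> subgroup_TPP G S T U ->
  ((#|S| * #|T| * #|U|) ^ 2 < #|G| ^ 2 * #|G : 'Z(G)|)%N.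
Proof.
move=> /andP[_ /and3P[_ sG'Z /andP[sZG nsGZ]]] tpp.
have v_gt1 : 1 < #|G : 'Z(G)| by rewrite indexg_gt1.
have /subgroup_TPP_P[[sS sT sU] _] := tpp.
set P := (_ * _ * _)%N.
(* Equality in the fourth power bound would force the central parts to fill
   the centre, hence to contain G'; that is the first case. *)
have [sG'D | nsG'D] := boolP (G^`(1) \subset
    (S :&: 'Z(G)) * (T :&: 'Z(G)) * (U :&: 'Z(G))).
  have leP : P <= #|G|.
    by rewrite /P -(tpp_card_mul3 tpp sG'D) subset_leq_card // !mul_subG.
  apply: (@leq_ltn_trans (#|G| ^ 2)%N); first by rewrite leq_exp2r.
  by rewrite -{1}[(#|G| ^ 2)%N]muln1 ltn_pmul2l // expn_gt0 cardG_gt0.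
have tppZ := @tpp_setI G S T U 'Z(G)%G tpp.
have card0 : (#|S :&: 'Z(G)| * #|T :&: 'Z(G)| * #|U :&: 'Z(G)| < #|'Z(G)|)%N.
  rewrite -(tpp_card_mul3 tppZ); last first.
    have /derG1P -> := center_abelian G.
    by rewrite sub1set -[1]mulg1 mem_mulg // -[1]mulg1 mem_mulg ?group1.
  apply: proper_card; rewrite properE !mul_subG ?subsetIr //=.
  by apply: contra nsG'D; apply: subset_trans.
rewrite -ltn_sqr -expnM; apply: (leq_ltn_trans (tpp_card_expn4_le tpp)).
have -> : ((#|G| ^ 2 * #|G : 'Z(G)|) ^ 2
          = #|G : 'Z(G)| ^ 6 * (#|'Z(G)| ^ 3 * #|'Z(G)|))%N.
  by rewrite -(Lagrange sZG) !expnS expn0; ring.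
by rewrite ltn_pmul2l ?ltn_pmul2l ?expn_gt0 ?indexg_gt0 ?cardG_gt0.
Qed.

End SubgroupTPPInClass2.

Local Open Scope ring_scope.

Theorem theorem3p1 (R : rcfType) (gT : finGroupType) (G : {group gT})
    (hG : nilpotent_class2 G) :
  rho0 R G < Num.sqrt (#|G : 'Z(G)|%g%:R).
Proof.
have [S [T [U [tpp ->]]]] := rho0_attained R G.
have := class2_tpp_lt hG tpp; set P := (_ * _ * _)%N => ltP.
have G_gt0 : (0 : R) < #|G|%:R by rewrite ltr0n cardG_gt0.
have ratio_ge0 : (0 : R) <= P%:R / #|G|%:R by rewrite divr_ge0 ?ler0n.
rewrite -[ltLHS]ger0_norm // -sqrtr_sqr ltr_sqrt ?ltr0n ?indexg_gt0 //.
rewrite expr_div_n ltr_pdivrMr ?exprn_gt0 //.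
by rewrite -!natrX -natrM ltr_nat mulnC.
Qed.
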